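(* (i) $E_{\lfloor n/2\rfloor}(n)\le 7$ for all integers $n\ge 1$. (ii) $E_{\lfloor n/2\rfloor}(n)\le 5$ for all integers $n\ge 100$. (iii) For any constant $0<\alpha\le 1/2$ there exists a constant $C=C_\alpha$ such that $E_{\lfloor \alpha n\rfloor}(n)\le C$ for all integers $n\ge 1$.
   Context: $[n]=\{1,\dots,n\}$ and $\binom{[n]}{k}$ is the set of $k$-element subsets of $[n]$. For integers $0\le k\le n$ and a function $f:\binom{[n]}{k}\to\{0,1\}$, the deterministic query complexity $D_k(f)$ is the minimum number $q$ such that there is a deterministic adaptive algorithm which, for every $A\in\binom{[n]}{k}$ (with $f$, $n$, $k$ known, $A$ unknown), correctly computes $f(A)$ using at most $q$ queries, where a query is an element $i\in[n]$ and its answer is whether $i\in A$ or $i\notin A$. Let $D_k(n)=\max\{D_k(f) : f:\binom{[n]}{k}\to\{0,1\}\}$ and $E_k(n)=n-D_k(n)$. *)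

(* Defs.v *)
From HB Require Import structures.
From mathcomp Require Import all_boot all_order all_algebra.
From mathcomp Require Import boolp.

Set Implicit Arguments.
Unset Strict Implicit.
Unset Printing Implicit Defensive.

Notation ksubset n k := {A : {set 'I_n} | #|A| == k}.

(* Deterministic adaptive algorithms: in [Query i no yes] the element i is
   queried, and the run goes on with [yes] if i \in A, with [no] otherwise. *)
Inductive algorithm (n : nat) : Type :=
| Answer of bool
| Query of 'I_n & algorithm n & algorithm n.

Arguments Answer {n} _.
Arguments Query {n} _ _ _.

Fixpoint output (n : nat) (t : algorithm n) (A : {set 'I_n}) : bool :=
  match t with
  | Answer b => b
  | Query i no yes => if i \in A then output yes A else output no A
  end.

Fixpoint queries (n : nat) (t : algorithm n) (A : {set 'I_n}) : nat :=
  match t with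
  | Answer _ => 0
  | Query i no yes => (if i \in A then queries yes A else queries no A).+1
  end.

Definition computes (n k : nat) (f : {ffun ksubset n k -> bool}) (q : nat)
    (t : algorithm n) : Prop :=
  forall A : ksubset n k, output t (val A) = f A /\ queries t (val A) <= q.

Definition computable_within (n k : nat) (f : {ffun ksubset n k -> bool})
    (q : nat) : Prop :=
  exists t : algorithm n, computes f q t.

Fixpoint query_all (n : nat) (g : {set 'I_n} -> bool) (s : seq 'I_n)
    (B : {set 'I_n}) : algorithm n :=
  match s with
  | [::] => Answer (g B)
  | i :: s' => Query i (query_all g s' B) (query_all g s' (i |: B))
  end.

Lemma output_query_all (n : nat) (g : {set 'I_n} -> bool) (s : seq 'I_n)
    (B A : {set 'I_n}) :
  output (query_all g s B) A = g (B :|: [set i in s | i \in A]).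
Proof.
elim: s B => [|i s IHs] B /=.
  by congr g; apply/setP => x; rewrite !inE orbF.
case: ifP => iA; rewrite IHs; congr g; apply/setP => x; rewrite !inE.
  by case: eqP => [->|_] /=; rewrite ?iA ?orbT.
by case: eqP => [->|_] //=; rewrite iA andbF.
Qed.

Lemma queries_query_all (n : nat) (g : {set 'I_n} -> bool) (s : seq 'I_n)
    (B A : {set 'I_n}) : queries (query_all g s B) A = size s.
Proof. by elim: s B => [|i s IHs] B //=; rewrite !IHs if_same. Qed.

Lemma computable_within_n (n k : nat) (f : {ffun ksubset n k -> bool}) :
  computable_within f n.
Proof.
exists (query_all (fun B => if insub B is Some A then f A else false)
                  (enum 'I_n) set0) => A.
rewrite queries_query_all size_enum_ord; split=> //.
rewrite output_query_all set0U.
have -> : [set i in enum 'I_n | i \in val A] = val A.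
  by apply/setP => x; rewrite inE mem_enum.
by rewrite valK.
Qed.

Lemma ex_computable_within (n k : nat) (f : {ffun ksubset n k -> bool}) :
  exists q : nat, `[< computable_within f q >].
Proof. by exists n; apply/asboolP; exact: computable_within_n. Qed.

Definition query_complexity (n k : nat) (f : {ffun ksubset n k -> bool}) : nat :=
  ex_minn (ex_computable_within f).

Definition max_query_complexity (k n : nat) : nat :=
  \max_(f : {ffun ksubset n k -> bool}) query_complexity f.

Lemma max_query_complexity_le (k n : nat) : max_query_complexity k n <= n.
Proof.
apply/bigmax_leqP => f _; rewrite /query_complexity.
case: ex_minnP => q _; apply.
by apply/asboolP; exact: computable_within_n.
Qed.

(* The subtraction does not truncate, by [max_query_complexity_le]. *)
Definition saved_queries (k n : nat) : nat := n - max_query_complexity k n.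

(* Main.v *)
(* A union bound over the first query, applied recursively.  Let N(m, j) bound
   the number of functions on a slice of weight j in dimension m that are
   computed with m - c queries.  The two answers to the first query lead to two
   independent subfunctions, so N(m, j) <= m N(m-1, j) N(m-1, j-1).  Since
   m (m+2) <= (m+1)^2, the quantity (m+2) N(m, j) is at most the product of its
   two predecessors, so its logarithm is dominated by any solution of Pascal's
   recursion that dominates it on the boundary: here 'C(m+2a, j+a) / D.  At
   (n, k) this solution is at most 'C(n, k), hence N(n, k) < 2 ^ 'C(n, k).
   For k = n/2, the parameters a = 5, D = 4^5, c = 6 do; for k = alpha n, take
   a = 1, D > 4 / alpha and c large. *)
Require Import Defs.
From HB Require Import structures.
From mathcomp Require Import all_boot all_order all_algebra.
From mathcomp Require Import boolp reals.
From mathcomp Require Import zify ring lra.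

Set Implicit Arguments.
Unset Strict Implicit.
Unset Printing Implicit Defensive.

Import Order.TTheory GRing.Theory Num.Theory.

(** * Trees with few queries, up to agreement on a slice *)

Notation cube_functions n := {set {ffun {set 'I_n} -> bool}}.

Definition glue (n : nat) (i : 'I_n) (g0 g1 : {ffun {set 'I_n} -> bool}) :
    {ffun {set 'I_n} -> bool} :=
  [ffun B : {set 'I_n} => if i \in B then g1 (B :\ i) else g0 B].

Definition constants (n : nat) : cube_functions n :=
  [set [ffun=> b] | b : bool].

(* Every function computed by a tree with at most d queries agrees with one of
   these on the sets B \subset S with #|B| = j, see [output_representatives];
   their values elsewhere are irrelevant. *)
Fixpoint representatives (n d : nat) (S : {set 'I_n}) (j : nat) : cube_functions n :=
  if d is d'.+1 then
    if 0 < j < #|S| then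
      \bigcup_(i in S) [set glue i g0 g1 |
        g0 in representatives d' (S :\ i) j,
        g1 in representatives d' (S :\ i) j.-1]
    else constants n
  else constants n.

Lemma card_constants (n : nat) : #|constants n| <= 2.
Proof. by rewrite (leq_trans (leq_imset_card _ _)) // card_bool. Qed.

Lemma constants_representatives (n : nat) (b : bool) (d : nat) (S : {set 'I_n})
    (j : nat) :
  [ffun=> b] \in representatives d S j.
Proof.
have bC : [ffun=> b] \in constants n by apply: imset_f.
elim: d S j => [|d IHd] S j //=; case: ifP => // /andP[j_gt0 ltjS].
have /card_gt0P[i iS] : 0 < #|S| by exact: leq_ltn_trans ltjS.
apply/bigcupP; exists i => //; apply/imset2P.
exists [ffun=> b] [ffun=> b]; rewrite ?IHd //.
by apply/ffunP => B; rewrite !ffunE if_same.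
Qed.

Lemma subset_card_trivial (n : nat) (S B : {set 'I_n}) (j : nat) :
  ~~ (0 < j < #|S|) -> B \subset S -> #|B| = j -> B = if j == 0 then set0 else S.
Proof.
move=> nj BS Bj; case: eqP => [j0|]; first by apply/cards0_eq; rewrite Bj.
by move=> j0; apply/eqP; rewrite eqEcard BS; lia.
Qed.

(** Here [T] holds the elements already known to lie in the unknown set, and [S] those not yet
    queried. In the induction on the tree, a query outside [S] has a forced answer, so only that
    branch is followed. *)
Lemma output_representatives (n : nat) (t : algorithm n) (d : nat)
    (S T : {set 'I_n}) (j : nat) :
    [disjoint S & T] ->
    (forall B : {set 'I_n}, B \subset S -> #|B| = j -> queries t (T :|: B) <= d) ->
  exists2 g, g \in representatives d S j &
    forall B : {set 'I_n}, B \subset S -> #|B| = j -> g B = output t (T :|: B).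
Proof.
elim: t d S T j => [b|i l IHl r IHr] d S T j dST tq.
  exists [ffun=> b]; first exact: constants_representatives.
  by move=> B _ _; rewrite ffunE.
(* At most one [B] remains here, so a constant agrees with any tree. *)
have [nj|] := boolP (~~ (0 < j < #|S|)).
  exists [ffun=> output (Query i l r) (T :|: (if j == 0 then set0 else S))].
    exact: constants_representatives.
  by move=> B BS Bj; rewrite ffunE -(subset_card_trivial nj BS Bj).
rewrite negbK => jS; have /andP[j_gt0 ltjS] := jS.
have [iS|iS] := boolP (i \in S); last first.
  have inB (B : {set 'I_n}) : B \subset S -> (i \in T :|: B) = (i \in T).
    by move=> BS; rewrite inE (contraNF (subsetP BS i)) ?orbF.
  have [iT|iT] := boolP (i \in T).
    have [|g gE gP] := IHr d S T j dST.
      move=> B BS Bj; have := tq B BS Bj.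
      by rewrite /= inB // iT; apply: leq_trans.
    by exists g => // B BS Bj; rewrite gP //= inB // iT.
  have [|g gE gP] := IHl d S T j dST.
    move=> B BS Bj; have := tq B BS Bj.
    by rewrite /= inB // (negPf iT); apply: leq_trans.
  by exists g => // B BS Bj; rewrite gP //= inB // (negPf iT).
have iT : i \notin T by rewrite (disjointFr dST iS).
case: d tq => [|d] tq.
  have /card_gt0P[B] : 0 < #|[set B : {set 'I_n} | B \subset S & #|B| == j]|.
    by rewrite cards_draws bin_gt0 ltnW.
  by rewrite inE => /andP[BS /eqP Bj]; have := tq B BS Bj.
have dl : [disjoint S :\ i & T] by apply: disjointWl dST; exact: subsetDl.
have dr : [disjoint S :\ i & i |: T].
  rewrite disjoint_sym disjoints_subset subUset sub1set !inE eqxx /=.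
  by rewrite -disjoints_subset disjoint_sym.
have [|g0 g0E g0P] := IHl d (S :\ i) T j dl.
  move=> B; rewrite subsetD1 => /andP[BS iB] Bj; have := tq B BS Bj.
  by rewrite /= inE (negPf iT) (negPf iB).
have [|g1 g1E g1P] := IHr d (S :\ i) (i |: T) j.-1 dr.
  move=> B; rewrite subsetD1 => /andP[BS iB] Bj.
  have := tq (i |: B); rewrite subUset sub1set iS BS cardsU1 iB Bj add1n.
  rewrite prednK // => /(_ isT erefl).
  by rewrite /= !inE eqxx orbT setUCA setUA.
exists (glue i g0 g1).
  rewrite /= jS; apply/bigcupP; exists i => //.
  by apply/imset2P; exists g0 g1.
move=> B BS Bj; rewrite ffunE /= inE (negPf iT) /=; case: ifP => iB.
  rewrite g1P ?setSD ?(cardsD1 i B) //; last by rewrite -Bj (cardsD1 i B) iB.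
  by rewrite -setUA setUCA setD1K.
by rewrite g0P // subsetD1 BS iB.
Qed.

(** * Bounding the number of representatives *)

(** The row is unimodal and symmetric, hence smallest at the ends of this range. One inequality per
    [m] then settles all cases where only constants remain. *)
Lemma leq_bin_shift (a m j : nat) :
  j <= m -> 'C(m + a.*2, a) <= 'C(m + a.*2, j + a).
Proof.
elim: m j => [|m IHm] [|j] // lejm.
have [->|jm] := eqVneq j m.
  rewrite -(@bin_sub _ a) ?leq_addl; last lia.
  by rewrite (_ : _ - a = m.+1 + a) //; lia.
rewrite !addSn binS; have h1 : j < m by lia.
have := leq_add (IHm _ h1) (IHm _ (ltnW h1)); rewrite addSn.
apply: leq_trans; case: a {IHm} => [|a]; first by rewrite !bin0.
rewrite binS leq_add2l -(leq_pmul2l (ltn0Sn a)) mul_bin_left.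
by apply: leq_mul => //; lia.
Qed.

Lemma sum_leq_card_mul (I : finType) (S : {set I}) (F : I -> nat) :
  0 < #|S| -> exists2 i, i \in S & \sum_(i in S) F i <= #|S| * F i.
Proof.
move=> S_gt0; have [i iS Fi] := eq_bigmax_cond F S_gt0.
exists i => //; rewrite -Fi -sum_nat_const.
by apply: leq_sum => k kS; apply: leq_bigmax_cond.
Qed.

Lemma card_representatives_rec (n d : nat) (S : {set 'I_n}) (j : nat) :
    0 < j < #|S| ->
  exists2 i, i \in S & #|representatives d.+1 S j| <=
    #|S| * (#|representatives d (S :\ i) j| *
            #|representatives d (S :\ i) j.-1|).
Proof.
move=> jS; have S_gt0 : 0 < #|S| by lia.
have [i iS le_i] := sum_leq_card_mul (fun i =>
  #|representatives d (S :\ i) j| * #|representatives d (S :\ i) j.-1|) S_gt0.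
exists i => //; apply: leq_trans le_i.
rewrite /= jS; elim/big_rec2: _ => [|k m A _ IH]; first by rewrite cards0.
apply: leq_trans (leq_card_setU _ _) _; apply: leq_add IH.
by rewrite curry_imset2X -cardsX leq_imset_card.
Qed.

(* The exponent D avoids dividing 'C(#|S| + 2a, j + a) by D in the exponent. *)
Lemma card_representatives (a D c n : nat) :
    0 < D ->
    (forall m, c <= m -> (2 * m.+2) ^ D <= 2 ^ 'C(m + a.*2, a)) ->
  forall (d : nat) (S : {set 'I_n}) (j : nat), #|S| = d + c -> j <= #|S| ->
  (#|representatives d S j| * #|S|.+2) ^ D <= 2 ^ 'C(#|S| + a.*2, j + a).
Proof.
move=> D_gt0 base.
have triv (d : nat) (S : {set 'I_n}) (j : nat) : #|S| = d + c -> j <= #|S| ->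
    (#|constants n| * #|S|.+2) ^ D <= 2 ^ 'C(#|S| + a.*2, j + a).
  move=> Sd lejS; have cS : c <= #|S| by rewrite Sd leq_addl.
  apply: (@leq_trans ((2 * #|S|.+2) ^ D)).
    by rewrite leq_exp2r // leq_mul2r card_constants.
  by apply: leq_trans (base _ cS) _; rewrite leq_exp2l // leq_bin_shift.
elim=> [|d IHd] S j Sd lejS; first exact: triv Sd lejS.
have [jS|jS] := boolP (0 < j < #|S|); last first.
  by rewrite /= (negPf jS); apply: triv Sd lejS.
have [i iS] := card_representatives_rec d jS.
set N := #|representatives d.+1 S j|.
have Si : #|S| = #|S :\ i|.+1 by rewrite (cardsD1 i) iS.
have Sid : #|S :\ i| = d + c by lia.
have lej : j <= #|S :\ i| by lia.
move: (leq_mul (IHd _ _ Sid lej) (IHd _ _ Sid (leq_trans (leq_pred j) lej))).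
rewrite -expnMn -expnD => le_b le_N.
have -> : 'C(#|S| + a.*2, j + a) =
    'C(#|S :\ i| + a.*2, j + a) + 'C(#|S :\ i| + a.*2, j.-1 + a).
  by rewrite Si -(ltn_predK (proj1 (andP jS))) !addSn binS.
apply: leq_trans le_b; rewrite leq_exp2r //.
apply: leq_trans (leq_mul le_N (leqnn _)) _.
(* With [s = #|S|], this rests on [s * (s + 2) <= (s + 1) ^ 2]. *)
rewrite Si; nia.
Qed.

(** * From counting to query complexity *)

(** A representative agreeing with [f] on the slice determines [f], so choosing one for each [f] is
    injective. *)
Lemma pow_bin_leq_card_representatives (n k q : nat) :
    (forall f : {ffun ksubset n k -> bool}, computable_within f q) ->
  2 ^ 'C(n, k) <= #|representatives q [set: 'I_n] k|.
Proof.
move=> comp.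
have ex_g (f : {ffun ksubset n k -> bool}) :
    exists g, g \in representatives q [set: 'I_n] k /\
      forall A : ksubset n k, g (val A) = f A.
  have [t tP] := comp f.
  have [||g gE gP] := @output_representatives n t q setT set0 k.
  - by rewrite disjoint_sym disjoints_subset sub0set.
  - move=> B _ /eqP Bk; rewrite set0U.
    by have [] := tP (exist _ B Bk).
  exists g; split=> // A.
  rewrite gP ?subsetT //; last exact/eqP/(valP A).
  by rewrite set0U; have [] := tP A.
have [h hP] := choice ex_g.
have h_inj : injective h.
  move=> f1 f2 eq_h; apply/ffunP => A.
  by rewrite -(proj2 (hP f1)) -(proj2 (hP f2)) eq_h.
have card_slice : #|{: ksubset n k}| = 'C(n, k).
  rewrite card_sig -[n in RHS]card_ord -card_draws.
  by apply: eq_card => B; rewrite !inE.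
have -> : 2 ^ 'C(n, k) = #|{ffun ksubset n k -> bool}|.
  by rewrite card_ffun card_bool card_slice.
rewrite -(card_codom h_inj); apply/subset_leq_card/subsetP => g.
by case/codomP => f ->; exact: (proj1 (hP f)).
Qed.

Lemma saved_queries_lt (a D c n k : nat) :
    0 < D -> 0 < c ->
    (forall m, c <= m -> (2 * m.+2) ^ D <= 2 ^ 'C(m + a.*2, a)) ->
    k <= n -> 'C(n + a.*2, k + a) <= D * 'C(n, k) ->
  saved_queries k n < c.
Proof.
move=> D_gt0 c_gt0 base lekn le_bin; rewrite /saved_queries.
have [ltnc|lecn] := ltnP n c; first exact: leq_ltn_trans (leq_subr _ _) ltnc.
rewrite ltnNge; apply/negP => le_max.
have comp (f : {ffun ksubset n k -> bool}) : computable_within f (n - c).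
  have : query_complexity f <= n - c.
    apply: (@leq_trans (max_query_complexity k n)); last by lia.
    exact: leq_bigmax.
  rewrite /query_complexity; case: ex_minnP => q /asboolP[t tP] _ le_q.
  by exists t => A; have [tA qA] := tP A; split=> //; exact: leq_trans le_q.
have := pow_bin_leq_card_representatives comp.
set N := #|_| => le_N.
have : (N * n.+2) ^ D <= (2 ^ 'C(n, k)) ^ D.
  rewrite -expnM (mulnC _ D).
  have := @card_representatives a D c n D_gt0 base (n - c) setT k.
  rewrite cardsT card_ord subnK // => /(_ erefl lekn) /leq_trans; apply.
  by rewrite leq_exp2l.
rewrite leq_exp2r // => le_N'.
(* Positivity forces [N > 0], against [N * n.+2 <= 2 ^ 'C(n, k) <= N]. *)
have : 0 < 2 ^ 'C(n, k) by rewrite expn_gt0.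
by nia.
Qed.

(** * Binomial and power estimates *)

Lemma bin_add2_succ (n k : nat) :
  k <= n -> (k.+1 * (n.+1 - k)) * 'C(n.+2, k.+1) = (n.+2 * n.+1) * 'C(n, k).
Proof.
move=> lekn.
have := mul_bin_diag n.+2 k; have := mul_bin_down n.+1 k; rewrite /= => e1 e2.
by rewrite -[in RHS]mulnA e1 mulnCA e2; ring.
Qed.

Lemma central_bin_add2 (n : nat) : 'C(n.+2, n.+2./2) <= 4 * 'C(n, n./2).
Proof.
have lekn : n./2 <= n by lia.
have := bin_add2_succ lekn; rewrite /=.
set B := 'C(n.+2, _); set B0 := 'C(n, _) => e.
(* The ratio of the two binomials is at most 4 for either parity of [n]. *)
have nn : n.+2 * n.+1 <= 4 * (n./2.+1 * (n.+1 - n./2)).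
  by have := odd_double_half n; case: (odd n) => /= <-; nia.
rewrite -(@leq_pmul2l (n./2.+1 * (n.+1 - n./2))); last by nia.
by rewrite e mulnCA mulnA leq_mul2r nn orbT.
Qed.

Lemma central_bin_shift (a n : nat) :
  'C(n + a.*2, n./2 + a) <= 4 ^ a * 'C(n, n./2).
Proof.
elim: a => [|a IHa]; first by rewrite mul1n !addn0.
have -> : n./2 + a.+1 = (n + a.*2).+2./2 by lia.
rewrite doubleS !addnS; apply: leq_trans (central_bin_add2 _) _.
rewrite expnS -mulnA leq_pmul2l //.
by have -> : (n + a.*2)./2 = n./2 + a by lia.
Qed.

(* D is kept abstract so that powers with this exponent are not evaluated. *)
Lemma pow_double_leq_pow2_bin (D m : nat) :
  0 < D <= 1024 -> 6 <= m -> (2 * m.+2) ^ D <= 2 ^ 'C(m + 5.*2, 5).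
Proof.
move=> /andP[D_gt0 leD] /subnK <-; elim: (m - 6) => [|p IHp].
  rewrite (_ : 2 * _ = 2 ^ 4); last by [].
  rewrite -expnM leq_exp2l; last by [].
  (* 4368 exceeds 4 * 1024, whereas [m = 5] would give only 3003; hence the threshold 6. *)
  rewrite (_ : 'C(_, _) = 4368) //; apply: leq_trans (leq_mul (leqnn 4) leD) _.
  by [].
rewrite addSn addSn binS [leqRHS]expnD.
(* Raising [m] by one at most doubles the base, while the exponent on the right gains at least
   1820. *)
apply: (@leq_trans ((2 * (p + 6).+2) ^ D * 2 ^ D)).
  by rewrite -expnMn leq_exp2r //; lia.
apply: leq_mul IHp _; rewrite leq_exp2l //; apply: leq_trans leD _.
have le16 : 16 <= p + 6 + 5.*2 by lia.
by apply: leq_trans (leq_bin2l 4 le16); rewrite (_ : 'C(_, _) = 1820).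
Qed.

Lemma leq_sqr_pow2 (q : nat) : 6 <= q -> q.+1 ^ 2 <= 2 ^ q.
Proof.
move=> /subnK <-; elim: (q - 6) => [//|p IHp].
by rewrite addSn [leqRHS]expnS; apply: leq_trans (leq_mul (leqnn 2) IHp); nia.
Qed.

(** The base condition for [a = 1]. With [x = m.+2] and [q = x %/ D], the bound on [m] gives
    [2 * D <= q], so [2 * x <= q.+1 ^ 2 <= 2 ^ q]; then take powers with exponent [D]. *)
Lemma pow_double_leq_pow2 (D m : nat) :
  0 < D -> D * (2 * D + 6) <= m -> (2 * m.+2) ^ D <= 2 ^ m.+2.
Proof.
move=> D_gt0 lem; set x := m.+2.
have leq_q : 2 * D + 6 <= x %/ D by rewrite leq_divRL // mulnC; lia.
apply: (@leq_trans (2 ^ (x %/ D * D))); last by rewrite leq_exp2l // leq_divM.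
rewrite expnM leq_exp2r //.
apply: leq_trans (leq_sqr_pow2 _); last lia.
have ltx : x < (x %/ D).+1 * D by rewrite ltn_ceil.
by nia.
Qed.

Local Open Scope ring_scope.

Theorem theorem1p3 (R : realType) :
  [/\ (forall n : nat, (1 <= n)%N -> (saved_queries n./2 n <= 7)%N),
      (forall n : nat, (100 <= n)%N -> (saved_queries n./2 n <= 5)%N)
    & (forall alpha : R, 0 < alpha -> alpha <= 1 / 2 ->
         exists C : nat, forall n : nat, (1 <= n)%N ->
           (saved_queries (Num.truncn (alpha * n%:R)) n <= C)%N)].
Proof.
(* The choice [c = 6] works for every [n], so (i) and (ii) follow together. *)
have half n : (saved_queries n./2 n <= 5)%N.
  have [D D_eq] : exists D, D = (4 ^ 5)%N by exists (4 ^ 5)%N.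
  have D_gt0 : (0 < D)%N by rewrite D_eq.
  apply: (@saved_queries_lt 5 D 6) => // [m lem||].
  - by apply: pow_double_leq_pow2_bin lem; rewrite D_gt0 D_eq.
  - by lia.
  - by rewrite D_eq; exact: central_bin_shift.
split=> [n _|n _|alpha a_gt0 a_le]; [by apply: leq_trans (half n) _ | exact: half |].
pose D := (Num.truncn (4 / alpha)).+1.
exists (D * (2 * D + 6))%N => n n_gt0; apply: ltnW.
set k := Num.truncn _.
have an_ge0 : 0 <= alpha * n%:R by rewrite mulr_ge0 // ltW.
have /andP[lek ltk] := truncn_itv an_ge0; rewrite -/k in lek ltk.
have D_gt : 4 < D%:R * alpha.
  have : 4 / alpha < D%:R by apply: truncnS_gt.
  by rewrite ltr_pdivrMr.
have le2k : (2 * k <= n)%N.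
  rewrite -(ler_nat R) natrM; have : (0 : R) < n%:R by rewrite ltr0n.
  by nra.
have leD : (4 * n <= D * k.+1)%N.
  rewrite -(ler_nat R) !natrM.
  have : (0 : R) < n%:R by rewrite ltr0n.
  have : (0 : R) < D%:R by rewrite ltr0n.
  by nra.
apply: (@saved_queries_lt 1 D) => //.
- by move=> m lem; rewrite addn2 bin1; apply: pow_double_leq_pow2.
- by lia.
rewrite addn2 addn1 -(@leq_pmul2l (k.+1 * (n.+1 - k))); last by nia.
rewrite bin_add2_succ; last by lia.
(* Multiply [n + 2 <= 2 * (n + 1 - k)], from [le2k], by [2 * (n + 1) <= 4 * n <= D * (k + 1)], from
   [n >= 1] and [leD]. *)
rewrite [leqRHS]mulnA leq_mul2r; apply/orP; right; nia.
Qed.
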